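(* For $n\ge1$ define \[ \widetilde\theta(n) = \begin{cases} 1 & \text{if } n = 3^a \text{ with } a \ge 1,\\ 0 & \text{otherwise.}\end{cases} \] Then the number of $n$-cycles in $S_n$ that avoid the consecutive pattern $\underline{321}$ is \[ \frac{1}{n}\left[\widetilde\theta(n) + \sum_{\substack{d\mid n\\ d\equiv 1 \bmod 3}} \mathrm{M\ddot{o}b}(d)\,(-1)^{(d-1)n/d}\,\gamma_{n/d} + (-1)^n\sum_{\substack{d\mid n\\ d\equiv 2\bmod 3}} \mathrm{M\ddot{o}b}(d)\,\gamma^*_{n/d}\right]. \]
   Context: $S_n$ is the symmetric group on $[n]=\{1,\dots,n\}$. An $n$-cycle is a permutation in $S_n$ consisting of a single cycle of length $n$. An ascent (resp. descent) of $\pi\in S_n$ is an index $i\in[n-1]$ with $\pi(i)<\pi(i+1)$ (resp. $\pi(i)>\pi(i+1)$). A permutation avoids the consecutive pattern $\underline{123}$ if it does not have two consecutive ascents, i.e. there is no $i$ with $\pi(i)<\pi(i+1)<\pi(i+2)$; it avoids $\underline{321}$ if it does not have two consecutive descents. $\gamma_n$ is the number of permutations in $S_n$ avoiding $\underline{123}$. For $n\ge2$, $\gamma_n^*$ is the number of permutations in $S_n$ that avoid $\underline{321}$ and begin and end with an ascent (i.e. $\pi(1)<\pi(2)$ and $\pi(n-1)<\pi(n)$); by convention $\gamma_0^*=1$ and $\gamma_1^*=0$. $\mathrm{M\ddot{o}b}$ is the number-theoretic Möbius function; sums over $d$ range over positive divisors. *)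

(* Defs.v *)
From mathcomp Require Import all_boot all_order all_fingroup all_algebra.

Set Implicit Arguments.
Unset Strict Implicit.
Unset Printing Implicit Defensive.

Import GRing.Theory.

(* Positions and values of a permutation of [n] are both shifted to
   0, ..., n - 1 by using 'S_n = {perm 'I_n}.  The index i of an ascent or
   descent is a nat; [ascent s i] and [descent s i] are false unless both i
   and i.+1 are positions. *)
Definition ascent n (s : 'S_n) (i : nat) : bool :=
  [exists x : 'I_n, exists y : 'I_n,
    [&& x == i :> nat, y == i.+1 :> nat & s x < s y]].

Definition descent n (s : 'S_n) (i : nat) : bool :=
  [exists x : 'I_n, exists y : 'I_n,
    [&& x == i :> nat, y == i.+1 :> nat & s y < s x]].

Definition avoids_123 n (s : 'S_n) : bool :=
  [forall i : 'I_n, ~~ (ascent s i && ascent s i.+1)].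

Definition avoids_321 n (s : 'S_n) : bool :=
  [forall i : 'I_n, ~~ (descent s i && descent s i.+1)].

Definition is_ncycle n (s : 'S_n) : bool := porbits s == [set [set: 'I_n]].

Definition gamma (n : nat) : nat := #|[set s : 'S_n | avoids_123 s]|.

Definition gamma_star (n : nat) : nat :=
  match n with
  | 0 => 1
  | 1 => 0
  | _ => #|[set s : 'S_n | [&& avoids_321 s, ascent s 0 & ascent s n.-2]]|
  end.

(* The Moebius function; only its values at d >= 1 are meaningful. *)
Definition mobius (d : nat) : int :=
  if all (fun p => logn p d == 1) (primes d)
  then ((-1) ^+ size (primes d))%R else 0%R.

(* The bound a < n on the exponent is harmless, since a < 3 ^ a = n. *)
Definition theta_tilde (n : nat) : nat :=
  [exists a : 'I_n, (1 <= a) && (n == 3 ^ a)].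

(* Main.v *)
Require Import Defs.
From mathcomp Require Import all_boot all_order all_fingroup all_algebra.
From mathcomp Require Import zify ring.

Set Implicit Arguments.
Unset Strict Implicit.
Unset Printing Implicit Defensive.

Import GRing.Theory.
Local Open Scope ring_scope.

(** Conjugating the cyclic shift by all [t : 'S_n] produces every [n]-cycle [s]
exactly [n] times, so [n] times the left-hand side counts the [t] whose cycle
[s], defined by [t (s x) = t x + 1], avoids two consecutive descents.

Fix a set [I] of positions and let [c] number the blocks into which [I] cuts
the positions.  The descents of [s] lie in [I] exactly when [s] increases on
each block.  Reading [c] along the cycle gives a word, [c] composed with
[t^-1], which is a rearrangement of [c].  If [s] increases on blocks, then
comparing [x] and [y] amounts to comparing lexicographically the rotations of
this word that start at [t x] and at [t y]; hence the word determines [t], and the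
words that occur are the primitive rearrangements of [c].  This is the theorem
of Gessel and Reutenauer for cycles.  Moebius inversion on the period replaces
primitive words by words of period [m = n / d].  Such rearrangements of [c]
exist only if [d] divides all the elements of [I]; then they are words of
length [m] on the blocks of [I / d], and standardization turns these into
permutations of ['S_m] with descents in [I / d].  The outcome is
[card_block_incr_cycle_of_mobius].

Avoidance is recovered by inclusion-exclusion.  The indicator that a set of
descents has no two consecutive elements is the sum, over the sets [I] that
contain it, of the number of sets without consecutive elements that contain
[I], counted with the sign of their number of elements outside [I].  This
coefficient is an entry of a product along [I] of two
matrices of size 2, [A = transfer false] and [B = transfer true].  After the
sum over [I], the divisor [d] contributes, for each [s : 'S_m], an entry of the
product over [j < m] of [A ^+ (d - 1)] times [B] at a descent, [A + B] at
another inner position, and [A] at the end ([sum_transfer_coef]).  Because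
[A ^+ 3 = -1], only [d] modulo 3 matters, up to sign: the entry is the indicator
- of no two consecutive descents if [d] is 1 modulo 3, which gives [gamma];
- of a first and a last descent without consecutive ascents if [d] is 2 modulo
  3, which gives [gamma_star] after complementing values;
- of no descent at all if 3 divides [d].  Only the identity remains, and the sum
  of [mobius] over the multiples of 3 dividing [n] is minus [theta_tilde n]. *)

(** * Sums of the Moebius function over divisors *)

Lemma mobius_prime_mul p e : prime p -> ~~ (p %| e)%N -> mobius (p * e) = - mobius e.
Proof.
move=> p_pr pNe; have e_gt0 : (0 < e)%N by case: e pNe => //; rewrite dvdn0.
have p_gt0 := prime_gt0 p_pr.
have pNe' : p \notin primes e by rewrite mem_primes p_pr e_gt0.
have eqpr : perm_eq (primes (p * e)) (p :: primes e).
  apply: uniq_perm; rewrite /= ?primes_uniq ?pNe' // => q.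
  by rewrite primesM // primes_prime // !inE.
have logpe : logn p e = 0%N by rewrite logn_coprime ?prime_coprime.
rewrite /mobius (perm_all _ eqpr) (perm_size eqpr) /= lognM // logpe.
rewrite logn_prime // eqxx addn0 eqxx /=.
have -> : all (fun q => logn q (p * e) == 1%N) (primes e)
        = all (fun q => logn q e == 1%N) (primes e).
  apply: eq_in_all => q q_e; rewrite lognM // logn_prime //.
  by have [eqp|_] := eqVneq q p; [rewrite eqp (negPf pNe') in q_e | rewrite add0n].
by case: ifP => _; rewrite ?oppr0 // exprS mulN1r.
Qed.

Lemma mobius_sq_dvd p e : prime p -> (0 < e)%N -> (p %| e)%N -> mobius (p * e) = 0.
Proof.
move=> p_pr e_gt0 p_e; have p_gt0 := prime_gt0 p_pr.
rewrite /mobius ifF //; apply/negbTE/allPn; exists p.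
  by rewrite mem_primes p_pr muln_gt0 p_gt0 e_gt0 dvdn_mulr.
rewrite lognM // logn_prime // eqxx.
have : (0 < logn p e)%N by rewrite logn_gt0 mem_primes p_pr e_gt0.
by case: (logn p e).
Qed.

(** Among the divisors that [p] divides, those that [p ^ 2] divides contribute
nothing, and the others are the [p * e] with [e] a divisor prime to [p]. *)
Lemma sum_mobius_dvd_prime n p : prime p -> (0 < n)%N -> (p %| n)%N ->
  \sum_(d <- divisors n | (p %| d)%N) mobius d
  = - \sum_(d <- divisors n | ~~ (p %| d)%N) mobius d.
Proof.
move=> p_pr n_gt0 p_n; have p_gt0 := prime_gt0 p_pr.
rewrite -big_filter -[in RHS]big_filter -sumrN.
rewrite (bigID (fun d => (p * p %| d)%N)) /= big1_seq ?add0r; last first.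
  move=> d /andP[/dvdnP[k ->]]; rewrite mem_filter => /andP[_].
  rewrite -dvdn_divisors // => kd; rewrite mulnC -mulnA mobius_sq_dvd ?dvdn_mulr //.
  have : (0 < k * (p * p))%N by apply: dvdn_gt0 kd.
  by rewrite !muln_gt0 => /and3P[-> _ _]; rewrite p_gt0.
rewrite -big_filter.
set s1 := [seq _ <- _ | _]; set s2 := [seq _ <- _ | _].
have eqs : perm_eq s1 (map (muln p) s2).
  apply: uniq_perm; rewrite ?filter_uniq ?divisors_uniq //.
    rewrite map_inj_uniq ?filter_uniq ?divisors_uniq // => x y /eqP.
    by rewrite eqn_pmul2l // => /eqP.
  move=> x; apply/idP/mapP => [|[y]].
    rewrite !mem_filter => /and3P[pp /dvdnP[k ek]].
    rewrite {}ek mulnC dvdn_pmul2l // in pp *.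
    rewrite -dvdn_divisors // => pkn; exists k => //.
    rewrite mem_filter pp /= -dvdn_divisors //.
    by apply: dvdn_trans pkn; rewrite dvdn_mull.
  rewrite mem_filter -!dvdn_divisors // => /andP[py yn] ->.
  rewrite !mem_filter dvdn_pmul2l // py dvdn_mulr //= -dvdn_divisors //.
  by rewrite Gauss_dvd ?p_n // prime_coprime.
rewrite (perm_big _ eqs) big_map big_filter [in RHS]big_filter.
by apply: eq_bigr => d pd; rewrite mobius_prime_mul.
Qed.

Lemma sum_mobius n : (0 < n)%N -> \sum_(d <- divisors n) mobius d = (n == 1%N)%:R.
Proof.
move=> n_gt0; have [->|n_neq1] := eqVneq n 1%N.
  by rewrite big_seq1.
have p_pr : prime (pdiv n) by apply: pdiv_prime; case: n n_gt0 n_neq1 => [|[]].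
rewrite (bigID (fun d => (pdiv n %| d)%N)) /=.
by rewrite sum_mobius_dvd_prime ?pdiv_dvd // addNr.
Qed.

(** If 3 divides [n], this is minus the sum over the divisors prime to 3, which are
all the divisors of the part of [n] prime to 3; that sum is 1 exactly when this
part is trivial. *)
Lemma sum_mobius_dvd3 n : (0 < n)%N ->
  \sum_(d <- divisors n | (3 %| d)%N) mobius d = - (theta_tilde n)%:R.
Proof.
move=> n_gt0; rewrite /theta_tilde; case: (boolP (3 %| n)%N) => [n3|nN3]; last first.
  rewrite big1_seq => [|d /andP[d3]]; last first.
    by rewrite -dvdn_divisors // => dn; rewrite (dvdn_trans d3 dn) in nN3.
  case: existsP => [[a /andP[a1 /eqP na]]|]; last by rewrite oppr0.
  by rewrite na dvdn_exp in nN3.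
rewrite sum_mobius_dvd_prime //; congr (- _).
have eqs : perm_eq [seq d <- divisors n | ~~ (3 %| d)%N] (divisors (n`_(3%N)^')).
  apply: uniq_perm; rewrite ?filter_uniq ?divisors_uniq // => d.
  rewrite mem_filter -!dvdn_divisors ?part_gt0 //.
  apply/andP/idP => [[d3 dn]|dn].
    by rewrite -[d](@part_pnat_id (3%N)^') ?p'natE // partn_dvd.
  have dn' : (d %| n)%N := dvdn_trans dn (dvdn_part _ _).
  by split=> //; rewrite -p'natE // (pnat_dvd dn) ?part_pnat.
rewrite -big_filter (perm_big _ eqs) sum_mobius ?part_gt0 //; congr ((_ : bool)%:R).
apply/eqP/existsP => [n1|[a /andP[a1 /eqP ->]]].
  have en : n = (3 ^ logn 3 n)%N by rewrite -p_part -[LHS](partnC 3%N n_gt0) n1 muln1.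
  have lt : (logn 3 n < n)%N by rewrite {2}en ltn_expl.
  exists (Ordinal lt) => /=; rewrite -en eqxx andbT.
  by rewrite logn_gt0 mem_primes n_gt0 n3.
by apply: part_p'nat; rewrite pnatNK pnatX.
Qed.

(** * Cycles as conjugates of the cyclic shift *)

Definition shiftp n : 'S_n := perm (@ordS_inj n).

(** This is the cycle [x |-> t^-1 (t x + 1)]: the bijection [t] gives the time at
which the cycle visits a point. *)
Definition cycle_of n (t : 'S_n) : 'S_n := (shiftp n ^ t^-1)%g.

Lemma shiftpX p k (x : 'I_p.+1) : (shiftp p.+1 ^+ k)%g x = inZp (x + k).
Proof.
elim: k => [|k IHk]; first by rewrite expg0 perm1 addn0 valZpK.
rewrite expgSr permM IHk permE; apply: val_inj => /=.
by rewrite -addn1 modnDml addn1 addnS.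
Qed.

Lemma cycle_ofXE p (t : 'S_p.+1) k x : t ((cycle_of t ^+ k)%g x) = inZp (t x + k).
Proof. by rewrite -conjXg conjgE invgK !permM permKV shiftpX. Qed.

Lemma cycle_ofE p (t : 'S_p.+1) x : t (cycle_of t x) = inZp (t x).+1.
Proof. by rewrite -[cycle_of t]expg1 cycle_ofXE addn1. Qed.

Lemma is_ncycleP n (s : 'S_n.+1) :
  reflect (forall x, porbit s x = setT) (is_ncycle s).
Proof.
apply: (iffP eqP) => [ps x|ps].
  by apply/set1P; rewrite -ps imset_f.
by apply/setP=> B; apply/imsetP/set1P => [[x _ ->]|->]; [|exists ord0].
Qed.

Lemma cycle_of_ncycle p (t : 'S_p.+1) : is_ncycle (cycle_of t).
Proof.
have orb0 y : y \in porbit (cycle_of t) (t^-1 ord0)%g.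
  apply/porbitP; exists (t y); apply: (@perm_inj _ t).
  by rewrite cycle_ofXE permKV add0n valZpK.
apply/is_ncycleP => x; apply/setP=> y; rewrite inE.
by have := orb0 x; rewrite -eq_porbit_mem => /eqP ->; rewrite orb0.
Qed.

(** [cycle_of t = s] means that [t x] is the number of steps of [s] from the point
[t^-1 0] to [x].  So [t] is determined by this base point, which is arbitrary. *)
Lemma card_cycle_of_fiber p (s : 'S_p.+1) : is_ncycle s ->
  #|[set t | cycle_of t == s]| = p.+1.
Proof.
move=> /is_ncycleP s_cyc.
pose f (t : 'S_p.+1) := (t^-1 ord0)%g.
have f_inj : {in [set t | cycle_of t == s] &, injective f}.
  move=> t t'; rewrite !inE => /eqP ts /eqP t's eqf.
  apply/permP=> x; have : x \in porbit s (f t) by rewrite s_cyc.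
  case/porbitP=> k ->; rewrite -{1}ts cycle_ofXE permKV eqf -t's cycle_ofXE permKV.
  by [].
rewrite -(card_in_imset f_inj) -[RHS]card_ord -cardsT; congr #|pred_of_set _|.
apply/setP=> x0; rewrite inE; apply/imsetP.
pose g (k : 'I_p.+1) := (s ^+ k)%g x0.
have cardo : #|porbit s x0| = p.+1 by rewrite s_cyc cardsT card_ord.
have g_inj : injective g.
  move=> i j eg; apply: val_inj; have := uniq_traject_porbit s x0.
  rewrite cardo => us; apply/eqP; rewrite /= -(nth_uniq x0 _ _ us) ?size_traject //.
  by rewrite !nth_traject // -!permX -/(g i) -/(g j) eg.
exists (perm g_inj)^-1%g; last by rewrite /f invgK permE /g expg0 perm1.
rewrite inE; apply/eqP/permP=> x; apply: (@perm_inj _ (perm g_inj)^-1%g).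
rewrite cycle_ofE; apply: (@perm_inj _ (perm g_inj)); rewrite permKV.
set k := (perm g_inj)^-1%g x; have -> : x = g k by rewrite -[RHS](permE g_inj) permKV.
rewrite permE /g -permM -expgSr /=; have : (k < p.+1)%N := ltn_ord k.
rewrite leq_eqVlt => /predU1P[kp|kp]; last by rewrite modn_small.
by rewrite kp modnn expg0 perm1 permX; have := iter_porbit s x0; rewrite cardo => ->.
Qed.

Lemma card_ncycles p (P : pred 'S_p.+1) :
  (p.+1 * #|[set s | is_ncycle s && P s]|)%N = #|[set t : 'S_p.+1 | P (cycle_of t)]|.
Proof.
rewrite -[RHS]sum1_card (partition_big (@cycle_of p.+1) (fun s => is_ncycle s && P s)).
  rewrite mulnC -sum_nat_const [in LHS](eq_bigl (fun s => is_ncycle s && P s)).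
    apply: eq_bigr => s /andP[/card_cycle_of_fiber cs Ps].
    rewrite -[LHS]cs -sum1_card; apply: eq_bigl => t; rewrite !inE.
    by case: eqP => [->|]; rewrite ?Ps ?andbF.
  by move=> s; rewrite inE.
by move=> t; rewrite inE cycle_of_ncycle.
Qed.

(** * Words and permutations sorted by a key *)

(** The maps [c] in use are nondecreasing: their fibers are intervals, the blocks. *)
Definition block_incr (c : nat -> nat) n (s : 'S_n) : bool :=
  [forall x : 'I_n, forall y : 'I_n, (x < y)%N && (c x == c y) ==> (s x < s y)%N].

Definition rearr (c : nat -> nat) n N (w : {ffun 'I_n -> 'I_N}) : bool :=
  perm_eq [seq val (w i) | i <- enum 'I_n] [seq c (val x) | x <- enum 'I_n].

Definition word_of (c : nat -> nat) n N (t : 'S_n) : {ffun 'I_n -> 'I_N.+1} :=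
  [ffun j => inord (c (t^-1 j)%g)].

Lemma block_incrP (c : nat -> nat) n (s : 'S_n) :
  reflect (forall x y : 'I_n, (x < y)%N -> c x = c y -> (s x < s y)%N) (block_incr c s).
Proof.
apply: (iffP forallP) => [H x y xy cxy|H x].
  by have /forallP/(_ y)/implyP := H x; apply; rewrite xy cxy eqxx.
by apply/forallP=> y; apply/implyP=> /andP[xy /eqP]; apply: H.
Qed.

Lemma map_perm_enum n (T : eqType) (f : 'I_n -> T) (t : 'S_n) :
  perm_eq [seq f (t x) | x <- enum 'I_n] [seq f x | x <- enum 'I_n].
Proof.
rewrite (map_comp f t); apply: perm_map; apply: uniq_perm.
- by rewrite (map_inj_uniq (@perm_inj _ t)) enum_uniq.
- exact: enum_uniq.
move=> x; rewrite mem_enum; apply/mapP; exists (t^-1 x)%g; rewrite ?permKV //.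
by rewrite mem_enum.
Qed.

(** Both functions enumerate the same multiset in increasing order. *)
Lemma homo_perm_eq n (f g : 'I_n -> nat) :
  (forall x y : 'I_n, (x < y)%N -> (f x <= f y)%N) ->
  (forall x y : 'I_n, (x < y)%N -> (g x <= g y)%N) ->
  perm_eq [seq f x | x <- enum 'I_n] [seq g x | x <- enum 'I_n] -> f =1 g.
Proof.
move=> f_mono g_mono fg x.
have srt h : (forall x y : 'I_n, (x < y)%N -> (h x <= h y)%N) ->
    sorted leq [seq h x | x <- enum 'I_n].
  move=> h_mono; apply: (@homo_sorted _ _ h (relpre val ltn)) => //.
  by rewrite -sorted_map val_enum_ord iota_ltn_sorted.
have := sorted_eq leq_trans anti_leq (srt _ f_mono) (srt _ g_mono) fg.
by move/eq_in_map; apply; rewrite mem_enum.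
Qed.

(** The inverse of [t] sends each index to the number of smaller keys. *)
Lemma rank_perm n (key : 'I_n -> nat) : injective key ->
  exists t : 'S_n, forall x y : 'I_n, (x < y)%N -> (key (t x) < key (t y))%N.
Proof.
case: n key => [|p] key key_inj; first by exists 1%g => -[].
pose rank i := #|[set j | (key j < key i)%N]|.
have rank_lt i j : (key i < key j)%N -> (rank i < rank j)%N.
  move=> kij; apply/proper_card/properP; split.
    by apply/subsetP=> k; rewrite !inE => /ltn_trans; apply.
  by exists i; rewrite !inE ?ltnn.
have rank_inj i j : rank i = rank j -> i = j.
  move=> eqr; apply: key_inj; case: (ltngtP (key i) (key j)) => // /rank_lt;
  by rewrite eqr ltnn.
have rank_ub i : (rank i < p.+1)%N.
  rewrite -[X in (_ < X)%N]card_ord -cardsT; apply/proper_card/properP.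
  by split; [exact: subsetT | exists i; rewrite !inE ?ltnn].
have r_inj : injective (fun i => Ordinal (rank_ub i)).
  by move=> i j [] /rank_inj.
exists (perm r_inj)^-1%g => x y xy; rewrite ltnNge; apply/negP.
have rk z : rank ((perm r_inj)^-1%g z) = z.
  by have := congr1 val (permKV (perm r_inj) z); rewrite permE.
rewrite leq_eqVlt => /predU1P[/key_inj/perm_inj eyx|/rank_lt].
  by rewrite eyx ltnn in xy.
by rewrite !rk ltnNge ltnW.
Qed.

Lemma rank_perm_uniq n (key : 'I_n -> nat) (t t' : 'S_n) : injective key ->
  (forall x y : 'I_n, (x < y)%N -> (key (t x) < key (t y))%N) ->
  (forall x y : 'I_n, (x < y)%N -> (key (t' x) < key (t' y))%N) -> t = t'.
Proof.
move=> key_inj tP t'P; apply/permP=> x; apply: key_inj; move: x.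
apply: homo_perm_eq => [x y /tP/ltnW //|x y /t'P/ltnW //|].
rewrite (perm_trans (map_perm_enum key t)) // perm_sym; exact: map_perm_enum.
Qed.

(** Listing the positions by [key] sorts the letters, because [key] refines their
order; and [c] is the only sorted rearrangement. *)
Lemma rearr_sorted (c : nat -> nat) n N (w : {ffun 'I_n -> 'I_N})
    (key : 'I_n -> nat) (t : 'S_n) :
  {homo c : x y / (x <= y)%N} -> rearr c w ->
  (forall i j, (w i < w j)%N -> (key i < key j)%N) ->
  (forall x y : 'I_n, (x < y)%N -> (key (t x) < key (t y))%N) ->
  forall x : 'I_n, w (t x) = c x :> nat.
Proof.
move=> c_mono cw wkey tkey; apply: homo_perm_eq.
- move=> x y xy; rewrite leqNgt; apply/negP => /wkey.
  by rewrite ltnNge ltnW ?tkey.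
- by move=> x y /ltnW/c_mono.
by rewrite (perm_trans (map_perm_enum (fun i => val (w i)) t)).
Qed.

Lemma word_ofE (c : nat -> nat) n N (t : 'S_n) x :
  (forall y, (y < n)%N -> (c y <= N)%N) ->
  word_of c N t (t x) = c x :> nat.
Proof. by move=> c_ub; rewrite ffunE permK inordK // ltnS c_ub. Qed.

Lemma rearr_word_of (c : nat -> nat) n N (t : 'S_n) :
  (forall y, (y < n)%N -> (c y <= N)%N) -> rearr c (word_of c N t).
Proof.
move=> c_ub; rewrite /rearr -(permPl (map_perm_enum _ t)) /=.
by rewrite (eq_map (fun x => word_ofE t x c_ub)).
Qed.

(** The common pattern of standardization and of the Gessel-Reutenauer bijection.
For each word [w], the key refines the order of the letters to a total order of
the positions; listing the positions in this order gives the only permutation of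
[A] whose word is [w]. *)
Lemma card_words_perms (c : nat -> nat) n N
    (key : {ffun 'I_n -> 'I_N.+1} -> 'I_n -> nat)
    (A : pred 'S_n) (X : pred {ffun 'I_n -> 'I_N.+1}) :
  {homo c : x y / (x <= y)%N} -> (forall y, (y < n)%N -> (c y <= N)%N) ->
  (forall w, X w -> rearr c w) ->
  (forall w, X w -> injective (key w)) ->
  (forall w, X w -> forall i j, (w i < w j)%N -> (key w i < key w j)%N) ->
  (forall w (t : 'S_n), X w -> (forall x : 'I_n, w (t x) = c x :> nat) ->
     A t <-> forall x y : 'I_n, (x < y)%N -> (key w (t x) < key w (t y))%N) ->
  (forall t, A t -> X (word_of c N t)) ->
  #|[set t | A t]| = #|[set w | X w]|.
Proof.
move=> c_mono c_ub Xr Xinj Xw XA AX.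
have wt_inj : {in [set t | A t] &, injective (word_of c N)}.
  move=> t t'; rewrite !inE => At At' eqw.
  have Xt := AX t At; have E u x := word_ofE u x c_ub.
  apply: (rank_perm_uniq (Xinj _ Xt)).
    by apply/(XA _ _ Xt) => // x; rewrite E.
  by apply/(XA _ _ Xt) => // x; rewrite eqw E.
rewrite -(card_in_imset wt_inj); congr #|pred_of_set _|; apply/setP=> w.
rewrite inE; apply/imsetP/idP => [[t]|Xw0]; first by rewrite inE => /AX Xt ->.
have [t tP] := rank_perm (Xinj w Xw0).
have wt := rearr_sorted c_mono (Xr w Xw0) (Xw w Xw0) tP.
exists t; first by rewrite inE; apply/(XA w).
apply/ffunP=> i; apply: val_inj; rewrite -[i](permKV t) /= wt.
by rewrite word_ofE.
Qed.

(** Standardization: equal letters are ordered by position, and the key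
[w i * n + i] expresses this order of pairs by numbers. *)
Lemma card_block_incr (c : nat -> nat) n N :
  {homo c : x y / (x <= y)%N} -> (forall y, (y < n)%N -> (c y <= N)%N) ->
  #|[set s : 'S_n | block_incr c s]|
  = #|[set w : {ffun 'I_n -> 'I_N.+1} | rearr c w]|.
Proof.
move=> c_mono c_ub.
have keyP (w : {ffun 'I_n -> 'I_N.+1}) (i j : 'I_n) :
    (w i * n + i < w j * n + j)%N = (w i < w j)%N || (w i == w j) && (i < j)%N.
  have := ltn_ord i; have := ltn_ord j.
  have [->|wij] := eqVneq (w i) (w j); first by rewrite ltn_add2l ltnn.
  rewrite orbF => jn iN; case: (ltngtP (w i) (w j)) => [lt|lt|/val_inj eqw].
  - have : ((w i).+1 * n <= w j * n)%N by rewrite leq_mul2r lt orbT.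
    by move=> le; apply/idP; lia.
  - have : ((w j).+1 * n <= w i * n)%N by rewrite leq_mul2r lt orbT.
    by move=> le; apply/negbTE; lia.
  by rewrite eqw eqxx in wij.
apply: (card_words_perms (c := c) (key := fun w i => (w i * n + i)%N)) => //.
- move=> w _ i j eqk; apply: val_inj => /=.
  have := keyP w i j; have := keyP w j i; rewrite eqk ltnn.
  move=> /esym/norP[w1 i1] /esym/norP[w2].
  have eqw : w i = w j by case: (ltngtP (w i) (w j)) w1 w2 => // /val_inj.
  by move: i1; rewrite eqw eqxx /=; case: ltngtP.
- by move=> w _ i j wij; rewrite keyP wij.
- move=> w t _ wt; split.
    move=> /block_incrP tP x y xy; rewrite keyP !wt -val_eqE /= !wt.
    have := c_mono _ _ (ltnW xy); rewrite leq_eqVlt => /predU1P[exy|->] //.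
    by rewrite exy eqxx tP ?orbT.
  move=> H; apply/block_incrP => x y /H; rewrite keyP !wt -val_eqE /= !wt.
  by move=> + exy; rewrite exy ltnn eqxx.
by move=> t _; apply: rearr_word_of.
Qed.

(** * Periods and rotations of words *)

Definition periodic n N (w : {ffun 'I_n.+1 -> 'I_N}) r :=
  [forall i : 'I_n.+1, w (inZp (i + r)) == w i].

Definition primitive n N (w : {ffun 'I_n.+1 -> 'I_N}) :=
  [forall r : 'I_n.+1, (0 < r)%N ==> ~~ periodic w r].

(** Indices are read cyclically, so that shifting them needs no wrapping around. *)
Definition letter n N (w : {ffun 'I_n.+1 -> 'I_N}) (k : nat) : nat := w (inZp k).

Lemma inZp_eq p i j : i = j %[mod p.+1] -> inZp i = inZp j :> 'I_p.+1.
Proof. by move=> eqij; apply: val_inj. Qed.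

Lemma letterDn n N (w : {ffun 'I_n.+1 -> 'I_N}) k : letter w (k + n.+1) = letter w k.
Proof. by rewrite /letter (inZp_eq (modnDr k n.+1)). Qed.

Lemma letter_mod n N (w : {ffun 'I_n.+1 -> 'I_N}) k :
  letter w (inZp k : 'I_n.+1) = letter w k.
Proof. by rewrite /letter; congr (val (w _)); apply: inZp_eq; rewrite /= modn_mod. Qed.

Lemma letter_val n N (w : {ffun 'I_n.+1 -> 'I_N}) (i : 'I_n.+1) : letter w i = w i.
Proof. by rewrite /letter valZpK. Qed.

Lemma periodicP n N (w : {ffun 'I_n.+1 -> 'I_N}) r :
  reflect (forall k, letter w (k + r) = letter w k) (periodic w r).
Proof.
apply: (iffP forallP) => [H k|H i].
  have /eqP/(congr1 val) := H (inZp k); rewrite /letter => <- /=.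
  by congr (val (w _)); apply: inZp_eq; rewrite modnDml.
by apply/eqP/val_inj; have := H i; rewrite /letter valZpK.
Qed.

(** The number with digits [f i], ..., [f (i + k - 1)] in base [B], the most
significant first.  The order of these numbers is the lexicographic order. *)
Fixpoint digits_val (B : nat) (f : nat -> nat) (i k : nat) : nat :=
  if k is k'.+1 then (digits_val B f i k' * B + f (i + k'))%N else 0%N.

Lemma digits_valSl B f i k :
  digits_val B f i k.+1 = (f i * B ^ k + digits_val B f i.+1 k)%N.
Proof.
elim: k => [|k IHk]; first by rewrite /= addn0 muln1 addn0.
by rewrite [LHS]/= -/(digits_val B f i k.+1) IHk /= expnSr addSnnS; lia.
Qed.

Lemma digits_val_ub B f i k : (forall j, (f j < B)%N) -> (digits_val B f i k < B ^ k)%N.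
Proof.
move=> fB; elim: k => //= k IHk; have := fB (i + k)%N; rewrite expnSr.
have : (((digits_val B f i k).+1) * B <= B ^ k * B)%N by rewrite leq_mul2r IHk orbT.
by rewrite mulSn; lia.
Qed.

Lemma eq_digits_val B f i j k : (forall l, f (i + l)%N = f (j + l)%N) ->
  digits_val B f i k = digits_val B f j k.
Proof. by move=> fij; elim: k => //= k ->; rewrite fij. Qed.

Definition rot_val n N (w : {ffun 'I_n.+1 -> 'I_N}) k :=
  digits_val N (letter w) k n.+1.

Lemma rot_val_mod n N (w : {ffun 'I_n.+1 -> 'I_N}) k :
  rot_val w (inZp k : 'I_n.+1) = rot_val w k.
Proof.
apply: eq_digits_val => l; rewrite /letter; congr (val (w _)).
by apply: inZp_eq; rewrite /= modnDml.
Qed.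

(** The first letter is the leading digit. *)
Lemma rot_val_lt n N (w : {ffun 'I_n.+1 -> 'I_N}) i j :
  (letter w i < letter w j)%N -> (rot_val w i < rot_val w j)%N.
Proof.
have ub l : (letter w l < N)%N by rewrite ltn_ord.
move=> wij; rewrite /rot_val !digits_valSl.
have := digits_val_ub i.+1 n ub.
have : ((letter w i).+1 * N ^ n <= letter w j * N ^ n)%N by rewrite leq_mul2r wij orbT.
by rewrite mulSn; lia.
Qed.

(** Rotating by one more step moves the leading digit to the end. *)
Lemma rot_valS n N (w : {ffun 'I_n.+1 -> 'I_N}) i :
  (rot_val w i.+1 + letter w i * N ^ n.+1 = rot_val w i * N + letter w i)%N.
Proof. by rewrite addnC -digits_valSl /= -/(rot_val w i) letterDn. Qed.

Lemma rot_val_ltS n N (w : {ffun 'I_n.+1 -> 'I_N}) i j : letter w i = letter w j ->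
  (rot_val w i.+1 < rot_val w j.+1)%N = (rot_val w i < rot_val w j)%N.
Proof.
move=> wij; have := rot_valS w i; have := rot_valS w j; rewrite wij => ej ei.
have N_gt0 : (0 < N)%N by rewrite (leq_trans _ (ltn_ord (w ord0))).
rewrite -(ltn_add2r (letter w j * N ^ n.+1)) ei ej ltn_add2r ltn_mul2r N_gt0.
by [].
Qed.

Lemma rot_val_eq n N (w : {ffun 'I_n.+1 -> 'I_N}) i j : rot_val w i = rot_val w j ->
  forall k, letter w (i + k) = letter w (j + k).
Proof.
move=> eqr k; have H x y : rot_val w x = rot_val w y -> letter w x = letter w y.
  by case: (ltngtP (letter w x) (letter w y)) => // /rot_val_lt + e; rewrite e ltnn.
apply: (H _ _); elim: k => [|k IHk]; first by rewrite !addn0.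
have /rot_val_ltS E := H _ _ IHk; have /rot_val_ltS E' := esym (H _ _ IHk).
rewrite !addnS; move: E E'; rewrite IHk ltnn.
by case: ltngtP.
Qed.

(** Two equal rotations would exhibit their distance as a period. *)
Lemma rot_val_inj n N (w : {ffun 'I_n.+1 -> 'I_N}) : primitive w ->
  injective (fun i : 'I_n.+1 => rot_val w i).
Proof.
move=> prim; have H (i j : 'I_n.+1) : (i < j)%N -> rot_val w i <> rot_val w j.
  move=> ij /rot_val_eq eqf.
  have ltr : (j - i < n.+1)%N by have := ltn_ord j; lia.
  have /forallP/(_ (Ordinal ltr)) := prim; rewrite /= subn_gt0 ij /=.
  move/negP; apply; apply/periodicP => k.
  rewrite -[LHS]letterDn -[RHS]letterDn.
  have -> : (k + (j - i) + n.+1 = j + (k + n.+1 - i))%N by have := ltn_ord i; lia.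
  by rewrite -eqf; congr (letter w _); have := ltn_ord i; lia.
move=> i j eqr; apply: val_inj => /=.
case: (ltngtP i j) => // ij; first by case: (H i j ij).
by case: (H j i ij).
Qed.

(** The periods are the multiples of the least one, [r0].  Hence [d] ranges over the
divisors of [n.+1 %/ r0], and the sum detects whether this quotient is 1. *)
Lemma periodic_sum_mobius n N (w : {ffun 'I_n.+1 -> 'I_N}) :
  \sum_(d <- divisors n.+1 | periodic w (n.+1 %/ d)) mobius d = (primitive w)%:R.
Proof.
have ex_per : exists r, (0 < r)%N && periodic w r.
  by exists n.+1; apply/periodicP => k; rewrite letterDn.
case: (ex_minnP ex_per) => r0 /andP[r0_gt0 /periodicP r0P] r0_min.
have mulP q k : letter w (k + q * r0) = letter w k.
  by elim: q k => [|q IHq] k; rewrite ?addn0 // mulSn addnA IHq r0P.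
have perE r : periodic w r = (r0 %| r)%N.
  apply/periodicP/dvdnP => [rP|[q ->] k]; last exact: mulP.
  exists (r %/ r0)%N; rewrite {1}(divn_eq r r0); case: (posnP (r %% r0)) => [->|].
    by rewrite addn0.
  move=> mod_gt0; have := r0_min (r %% r0)%N; rewrite mod_gt0 /= leqNgt ltn_pmod //.
  suff -> : periodic w (r %% r0) by move/(_ isT).
  by apply/periodicP=> k; rewrite -(mulP (r %/ r0)%N) -addnA [(_ %% _ + _)%N]addnC -divn_eq.
have r0n : (r0 %| n.+1)%N by rewrite -perE; apply/periodicP => k; rewrite letterDn.
have q_gt0 : (0 < n.+1 %/ r0)%N by rewrite divn_gt0 // (dvdn_leq _ r0n).
have -> : primitive w = (n.+1 %/ r0 == 1)%N.
  rewrite -(eqn_pmul2r r0_gt0) divnK // mul1n eq_sym.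
  apply/forallP/eqP => [prim|er0 r]; last first.
    apply/implyP=> r_gt0; rewrite perE er0; apply/negP=> /dvdn_leq.
    by move=> /(_ r_gt0); rewrite leqNgt ltn_ord.
  apply/eqP; rewrite eqn_leq (dvdn_leq _ r0n) //= leqNgt; apply/negP => lt.
  by have := prim (Ordinal lt); rewrite /= r0_gt0 perE dvdnn.
rewrite -sum_mobius // -big_filter; apply: perm_big; apply: uniq_perm.
- by rewrite filter_uniq ?divisors_uniq.
- exact: divisors_uniq.
move=> d; rewrite mem_filter perE -!dvdn_divisors //.
have [->|d_gt0] := posnP d; first by rewrite !dvd0n (gtn_eqF q_gt0) andbF.
apply/andP/idP => [[H dn]|H].
  by rewrite -(dvdn_pmul2r r0_gt0) divnK // mulnC -(divnK dn) dvdn_pmul2r.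
have dn : (d %| n.+1)%N by rewrite (dvdn_trans H) // dvdn_div.
by split=> //; rewrite -(dvdn_pmul2r d_gt0) divnK // mulnC -(divnK r0n) dvdn_pmul2r.
Qed.

(** * Cycles with prescribed descents and primitive words *)

(** The theorem of Gessel and Reutenauer for cycles.  Let [s = cycle_of t] increase
on blocks, and let [x < y] be such that the rotation of the word from [t x] is
not smaller than the one from [t y].  Then [x] and [y] lie in the same block, so
[s x < s y], and the situation repeats at [s x] and [s y]; all letters of the two
rotations agree, against primitivity.  Conversely the word of such an [s] is
primitive: if it had a period [r], then comparing the points visited at times
[0], [r], [2 * r], and so on would give a strictly monotone sequence that
returns to its start. *)
Lemma card_block_incr_cycle_of (c : nat -> nat) p N :
  {homo c : x y / (x <= y)%N} -> (forall y, (y < p.+1)%N -> (c y <= N)%N) ->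
  #|[set t : 'S_p.+1 | block_incr c (cycle_of t)]|
  = #|[set w : {ffun 'I_p.+1 -> 'I_N.+1} | rearr c w && primitive w]|.
Proof.
move=> c_mono c_ub.
have step (w : {ffun 'I_p.+1 -> 'I_N.+1}) (t : 'S_p.+1) x :
    rot_val w (t (cycle_of t x)) = rot_val w (t x).+1.
  by rewrite cycle_ofE rot_val_mod.
apply: (card_words_perms (c := c) (key := fun w i => rot_val w i)
  (X := fun w => rearr c w && primitive w)) => //.
- by move=> w /andP[].
- by move=> w /andP[_ /rot_val_inj].
- by move=> w _ i j wij; apply: rot_val_lt; rewrite !letter_val.
- move=> w t /andP[_ /rot_val_inj w_inj] wt.
  have lt x : letter w (t x) = c x by rewrite letter_val.
  split=> [/block_incrP t_incr|H]; last first.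
    apply/block_incrP=> x y xy exy; rewrite ltnNge leq_eqVlt; apply/negP.
    case/predU1P=> [/val_inj/perm_inj eyx|/H]; first by rewrite eyx ltnn in xy.
    rewrite !step rot_val_ltS ?lt // ltnNge; apply/negP.
    by rewrite negbK ltnW ?H.
  move=> x y xy; rewrite ltnNge; apply/negP=> le_r.
  have iterP k : [/\ ((cycle_of t ^+ k)%g x < (cycle_of t ^+ k)%g y)%N,
      c ((cycle_of t ^+ k)%g x) = c ((cycle_of t ^+ k)%g y) &
      (rot_val w (t ((cycle_of t ^+ k)%g y)) <= rot_val w (t ((cycle_of t ^+ k)%g x)))%N].
    have ceq (u v : 'I_p.+1) : (u < v)%N -> (rot_val w (t v) <= rot_val w (t u))%N -> c u = c v.
      move=> uv; apply: contraTeq => neq; rewrite -ltnNge; apply: rot_val_lt.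
      by rewrite !lt ltn_neqAle neq c_mono // ltnW.
    elim: k => [|k [IH1 IH2 IH3]]; first by rewrite expg0 !perm1; split=> //; apply: ceq.
    rewrite expgSr !(permM (_ ^+ k)%g).
    move: ((cycle_of t ^+ k)%g x) ((cycle_of t ^+ k)%g y) IH1 IH2 IH3 => u v IH1 IH2 IH3.
    have uv := t_incr _ _ IH1 IH2.
    have le : (rot_val w (t (cycle_of t v)) <= rot_val w (t (cycle_of t u)))%N.
      by rewrite !step leqNgt rot_val_ltS ?lt // -leqNgt.
    by split=> //; apply: ceq.
  have /w_inj/perm_inj eqxy : rot_val w (t x) = rot_val w (t y).
    apply: eq_digits_val => k; have [_ + _] := iterP k.
    by rewrite -!lt !cycle_ofXE !letter_mod.
  by rewrite eqxy ltnn in xy.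
move=> t /block_incrP t_incr; rewrite rearr_word_of //=.
apply/forallP=> r; apply/implyP=> r_gt0; apply/negP => /periodicP perw.
set w := word_of c N t in perw.
have lt x : letter w (t x) = c x by rewrite letter_val word_ofE.
(* [z k] is the point visited at time [k]. *)
pose z k := (cycle_of t ^+ k)%g (t^-1 ord0)%g.
have tz k : t (z k) = inZp k by rewrite cycle_ofXE permKV add0n.
have cz k : c (z (k + r)%N) = c (z k).
  by rewrite -!lt !tz !letter_mod perw.
have zS k : z k.+1 = cycle_of t (z k) by rewrite /z expgSr permM.
have zn k : z (k + p.+1)%N = z k.
  by apply: (@perm_inj _ t); rewrite !tz; apply: inZp_eq; rewrite modnDr.
have zinj : z r <> z 0%N.
  move/(congr1 t); rewrite !tz => /(congr1 val) /=.
  by rewrite mod0n modn_small ?ltn_ord // => r0; rewrite r0 in r_gt0.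
have zper j k : z (k + j * p.+1)%N = z k.
  by elim: j k => [|j IHj] k; rewrite ?addn0 // mulSn addnA IHj zn.
have zrn : z (p.+1 * r)%N = z 0%N by rewrite mulnC -[(r * _)%N]add0n zper.
case: (ltngtP (z r) (z 0%N)) => [lt0|gt0|/val_inj //].
  have H k : (z (k + r)%N < z k)%N.
    by elim: k => [//|k IHk]; rewrite addSn !zS; apply: t_incr; rewrite ?cz.
  have H' j : (z (j * r)%N + j <= z 0%N)%N.
    elim: j => [|j IHj]; rewrite ?addn0 // mulSn addnC.
    by have := H (j * r)%N; rewrite [(r + _)%N]addnC; lia.
  by have := H' p.+1; rewrite zrn; lia.
have H k : (z k < z (k + r)%N)%N.
  by elim: k => [//|k IHk]; rewrite addSn !zS; apply: t_incr; rewrite ?cz.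
have H' j : (z 0%N + j <= z (j * r)%N)%N.
  elim: j => [|j IHj]; rewrite ?addn0 // mulSn.
  by have := H (j * r)%N; rewrite [(r + _)%N]addnC; lia.
by have := H' p.+1; rewrite zrn; lia.
Qed.

Lemma rearrP (c : nat -> nat) n N (w : {ffun 'I_n.+1 -> 'I_N}) :
  reflect (forall P : pred nat,
    (\sum_(0 <= i < n.+1) P (letter w i) = \sum_(0 <= x < n.+1) P (c x))%N)
  (rearr c w).
Proof.
have cnt (P : pred nat) (f : nat -> nat) (g : 'I_n.+1 -> nat) :
    (forall i : 'I_n.+1, f i = g i) ->
    count P [seq g i | i <- enum 'I_n.+1] = (\sum_(0 <= i < n.+1) P (f i))%N.
  move=> fg; rewrite -sum1_count big_map big_enum_cond big_mkord big_mkcond.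
  by apply: eq_bigr => i _; rewrite fg; case: (P _).
apply: (iffP seq.permP) => H P; have := H P.
  by rewrite (cnt _ (letter w)) ?(cnt _ c) //; apply: letter_val.
by rewrite (cnt _ (letter w)) ?(cnt _ c) //; apply: letter_val.
Qed.

Lemma sum_mod_mul (f : nat -> nat) m d :
  (forall k, f (k + m) = f k)%N ->
  (\sum_(0 <= i < d * m) f i = d * \sum_(0 <= i < m) f i)%N.
Proof.
move=> fP; rewrite big_nat_mul.
have fPq q k : f (k + q * m)%N = f k.
  by elim: q k => [|q IHq] k; rewrite ?addn0 // mulSn addnA IHq fP.
rewrite (eq_bigr (fun=> \sum_(0 <= i < m) f i)%N) ?sum_nat_const_nat ?subn0 // => q _.
rewrite -{1}[(q * m)%N]add0n big_addn mulSn addnK.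
by apply: eq_bigr => k _; rewrite fPq.
Qed.

Lemma sum_div_mul (g : nat -> nat) m d : (0 < d)%N ->
  (\sum_(0 <= x < m * d) g (x %/ d) = d * \sum_(0 <= y < m) g y)%N.
Proof.
move=> d_gt0; rewrite big_nat_mul big_distrr /=; apply: eq_bigr => y _.
rewrite -{1}[(y * d)%N]add0n big_addn mulSn addnK.
rewrite (eq_big_nat _ _ (F2 := fun _ => g y)) ?sum_nat_const_nat ?subn0 // => k /andP[_ kd].
by rewrite addnC divnMDl // divn_small // addn0.
Qed.

Lemma sum_ltn_const k n : (k <= n)%N -> (\sum_(0 <= y < n) (y < k) = k)%N.
Proof.
move=> kn; rewrite (big_cat_nat _ (n := k)) //= [X in (_ + X)%N]big1_seq ?addn0.
  rewrite (eq_big_nat _ _ (F2 := fun _ => 1%N)) ?sum_nat_const_nat ?subn0 ?muln1 //.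
  by move=> i /andP[_ ->].
by move=> i; rewrite mem_index_iota => /andP[_ /andP[ki _]]; rewrite ltnNge ki.
Qed.

(** A word of period [q.+1] repeats [d] times a word of length [q.+1], so each letter
occurs a multiple of [d] times.  As the blocks of [c] have these sizes, [c] is
constant between consecutive multiples of [d]. *)
Lemma card_rearr_periodic (c : nat -> nat) p q d N :
  {homo c : x y / (x <= y)%N} -> p.+1 = (d * q.+1)%N ->
  #|[set w : {ffun 'I_p.+1 -> 'I_N} | rearr c w && periodic w q.+1]|
  = if [forall x : 'I_p.+1, c x == c (x %/ d * d)%N]
    then #|[set v : {ffun 'I_q.+1 -> 'I_N} | rearr (fun y => c (y * d)%N) v]|
    else 0%N.
Proof.
move=> c_mono epq; have d_gt0 : (0 < d)%N by case: d epq.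
have sum_per (w : {ffun 'I_p.+1 -> 'I_N}) (P : pred nat) : periodic w q.+1 ->
    (\sum_(0 <= i < p.+1) P (letter w i) = d * \sum_(0 <= i < q.+1) P (letter w i))%N.
  by move=> /periodicP wP; rewrite epq sum_mod_mul // => k; rewrite wP.
case: ifPn => [/forallP cd|]; last first.
  case/forallPn=> x xd; apply/eqP; rewrite cards_eq0; apply/eqP/setP=> w.
  rewrite !inE; apply/negbTE/negP=> /andP[/rearrP cw wP].
  pose P : pred nat := fun a => (a < c x)%N.
  have sumE := cw P; rewrite sum_per // in sumE.
  have x0_lt : (c (x %/ d * d) < c x)%N.
    by rewrite ltn_neqAle eq_sym xd c_mono // leq_trunc_div.
  have ub : (\sum_(0 <= y < p.+1) P (c y) <= x)%N.
    rewrite -[X in (_ <= X)%N](sum_ltn_const (ltnW (ltn_ord x))).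
    apply: leq_sum => y _; case: (ltnP y x) => [_|/c_mono]; first by case: (P _).
    by rewrite /P leqNgt => /negbTE ->.
  have lb : (x %/ d * d < \sum_(0 <= y < p.+1) P (c y))%N.
    rewrite -[X in (X <= _)%N](@sum_ltn_const _ p.+1); last first.
      by rewrite (leq_ltn_trans (leq_trunc_div _ _)).
apply: leq_sum => y _; case: (ltnP y _) => [|_]; last by [].
    by rewrite ltnS /P => /c_mono/leq_ltn_trans ->.
  move: lb ub; rewrite -sumE mulnC ltn_pmul2l // [(d * _)%N]mulnC -leq_divRL //.
  by rewrite ltnNge => /negbTE ->.
pose ext (v : {ffun 'I_q.+1 -> 'I_N}) : {ffun 'I_p.+1 -> 'I_N} :=
  [ffun i : 'I_p.+1 => v (inZp i)].
have extE v k : letter (ext v) k = letter v k.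
  rewrite /letter ffunE; congr (val (v _)); apply: inZp_eq => /=.
  by rewrite epq modn_dvdm // dvdn_mull.
have ext_inj : injective ext.
  move=> v v' evv; apply/ffunP=> i; apply: val_inj.
  by rewrite /= -!letter_val -!extE evv.
have ext_per v : periodic (ext v) q.+1.
  by apply/periodicP=> k; rewrite !extE letterDn.
have ext_rearr v : rearr c (ext v) = rearr (fun y => c (y * d)%N) v.
  have E (P : pred nat) : (\sum_(0 <= x < p.+1) P (c x)
      = d * \sum_(0 <= y < q.+1) P (c (y * d)))%N.
    rewrite -(sum_div_mul (fun y => P (c (y * d)%N) : nat)) // mulnC -epq.
    by rewrite !big_mkord; apply: eq_bigr => x _; rewrite (eqP (cd x)).
  have E' (P : pred nat) : (\sum_(0 <= x < p.+1) P (letter (ext v) x)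
      = d * \sum_(0 <= y < q.+1) P (letter v y))%N.
    by rewrite sum_per //; congr (_ * _)%N; apply: eq_bigr => i _; rewrite extE.
  apply/rearrP/rearrP=> H P; last by rewrite E E' H.
  by apply/eqP; rewrite -(eqn_pmul2l d_gt0) -E -E' H.
rewrite -(card_imset _ ext_inj); congr #|pred_of_set _|; apply/setP=> w.
rewrite inE; apply/andP/imsetP => [[cw wP]|[v]]; last first.
  by rewrite inE -ext_rearr => cv ->.
have ew : w = ext [ffun j : 'I_q.+1 => w (inZp j)].
  apply/ffunP=> i; apply: val_inj => /=; rewrite -!letter_val extE.
  have wPq k j : letter w (j + k * q.+1) = letter w j.
    by elim: k j => [|k IHk] j; rewrite ?addn0 // mulSn addnA IHk; apply/periodicP.
  by rewrite {1}(divn_eq i q.+1) addnC wPq {2}/letter ffunE /letter.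
by exists [ffun j : 'I_q.+1 => w (inZp j)]; rewrite // inE -ext_rearr -ew.
Qed.

(** Moebius inversion replaces primitive words by periodic ones, which are words
of length [p.+1 %/ d]; standardization then turns words into permutations. *)
Lemma card_block_incr_cycle_of_mobius (c : nat -> nat) p :
  {homo c : x y / (x <= y)%N} ->
  #|[set t : 'S_p.+1 | block_incr c (cycle_of t)]|%:R
  = \sum_(d <- divisors p.+1) mobius d *
      (if [forall x : 'I_p.+1, c x == c (x %/ d * d)%N]
       then #|[set s : 'S_(p.+1 %/ d) | block_incr (fun y => c (y * d)%N) s]|
       else 0%N)%:R.
Proof.
move=> c_mono; have c_ub y : (y < p.+1)%N -> (c y <= c p)%N by move=> yp; apply: c_mono.
rewrite (card_block_incr_cycle_of c_mono c_ub) -sum1_card natr_sum.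
under eq_bigl => w do rewrite inE.
rewrite big_mkcondr /= (eq_bigr (fun w => \sum_(d <- divisors p.+1)
   mobius d * (periodic w (p.+1 %/ d))%:R)); last first.
  move=> w _; rewrite (_ : (if _ then _ else _) = (primitive w)%:R); last by case: ifP.
  rewrite -periodic_sum_mobius big_mkcond; apply: eq_bigr => d _.
  by case: ifP; rewrite ?mulr1 ?mulr0.
rewrite exchange_big /= big_seq [RHS]big_seq; apply: eq_bigr => d.
rewrite -dvdn_divisors // => dn; rewrite -mulr_sumr; congr (_ * _).
rewrite -natr_sum; congr (_%:R); rewrite -big_mkcondr /= sum1_card.
have : (0 < p.+1 %/ d)%N by rewrite divn_gt0 ?(dvdn_leq _ dn) ?(dvdn_gt0 _ dn).
have : p.+1 = (d * (p.+1 %/ d))%N by rewrite mulnC divnK.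
case: (p.+1 %/ d)%N => // q epq _.
rewrite (@card_block_incr _ _ (c p)) => [|x y xy|y yq].
- rewrite -(card_rearr_periodic _ c_mono epq); apply: eq_card => w.
  by rewrite !inE.
- by rewrite c_mono // leq_mul2r xy orbT.
by apply: c_mono; rewrite -ltnS epq mulnC ltn_pmul2l //; case: d epq {dn}.
Qed.

(** * Descent sets and blocks *)

Lemma descentP n (s : 'S_n) i :
  reflect (exists x y : 'I_n, [/\ x = i :> nat, y = i.+1 :> nat & (s y < s x)%N])
    (descent s i).
Proof.
apply: (iffP existsP) => [[x /existsP[y /and3P[/eqP ? /eqP ? ?]]]|[x [y [xi yi lt]]]].
  by exists x, y.
by exists x; apply/existsP; exists y; rewrite xi yi !eqxx.
Qed.

Lemma descent_lt n (s : 'S_n.+1) i : descent s i -> (i < n)%N.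
Proof. by case/descentP=> x [y [_ yi _]]; rewrite -ltnS -yi. Qed.

Lemma descentE n (s : 'S_n) (x y : 'I_n) : y = x.+1 :> nat ->
  descent s x = (s y < s x)%N.
Proof.
move=> yx; apply/descentP/idP => [[x' [y' [ex ey]]]|lt]; last by exists x, y.
have -> : x' = x by apply: val_inj.
by have -> : y' = y by apply: val_inj; rewrite /= ey yx.
Qed.

Lemma ndescentE n (s : 'S_n) (x y : 'I_n) : y = x.+1 :> nat ->
  ~~ descent s x = (s x < s y)%N.
Proof.
move=> yx; rewrite (descentE s yx); case: ltngtP => // /val_inj/perm_inj eyx.
by move: yx; rewrite eyx => /n_Sn.
Qed.

(** Inside a block there is no descent, so [s] increases one step after another. *)
Lemma block_incr_descent (c : nat -> nat) n (s : 'S_n) :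
  {homo c : x y / (x <= y)%N} ->
  block_incr c s <-> (forall i, descent s i -> (c i < c i.+1)%N).
Proof.
move=> c_mono; split=> [/block_incrP H i|H].
  case/descentP=> x [y [xi yi lt]]; rewrite ltn_neqAle c_mono // andbT.
  apply: contraTneq lt => exy; rewrite -leqNgt ltnW // H ?xi ?yi //.
apply/block_incrP=> x [y yn]; elim: y yn => // y IHy yn /=.
have y'n : (y < n)%N by apply: ltnW.
rewrite ltnS => xy cxy.
have ey : c y = c y.+1.
  by apply/eqP; rewrite eqn_leq c_mono //= -cxy c_mono // ltnW.
have lt : (s (Ordinal y'n) < s (Ordinal yn))%N.
  by rewrite -ndescentE //; apply/negP=> /H; rewrite /= ey ltnn.
move: xy; rewrite leq_eqVlt => /predU1P[exy|xy].
  by rewrite (_ : x = Ordinal y'n) //; apply: val_inj.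
by apply: ltn_trans lt; apply: IHy; rewrite //= ey.
Qed.

(** A position [i] in [I] cuts between [i] and [i.+1], where a descent at [i] takes
place. *)
Definition block_index n (I : {ffun 'I_n -> bool}) (x : nat) : nat :=
  \sum_(i < n | (i < x)%N) I i.

Lemma block_index_mono n (I : {ffun 'I_n -> bool}) : {homo block_index I : x y / (x <= y)%N}.
Proof.
move=> x y xy; rewrite /block_index [X in (X <= _)%N]big_mkcond [X in (_ <= X)%N]big_mkcond.
apply: leq_sum => i _; case: ltnP => // ix.
by rewrite (leq_trans ix xy).
Qed.

Lemma block_indexS n (I : {ffun 'I_n -> bool}) (i : 'I_n) :
  block_index I i.+1 = (block_index I i + I i)%N.
Proof.
rewrite /block_index (bigD1 i) //= addnC; congr (_ + _)%N.
by apply: eq_bigl => j; rewrite ltnS leq_eqVlt -val_eqE /=; case: ltngtP.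
Qed.

Lemma block_index_eq n (I : {ffun 'I_n -> bool}) x y : (x <= y)%N ->
  (forall i : 'I_n, (x <= i < y)%N -> ~~ I i) -> block_index I x = block_index I y.
Proof.
move=> xy H; rewrite /block_index big_mkcond [RHS]big_mkcond.
apply: eq_bigr => i _.
case: (ltnP i x) => ix; first by rewrite (leq_trans ix xy).
case: ltnP => // iy; by rewrite (negPf (H i _)) // ix.
Qed.

(** The cut at [i] leaves [i.+1] points on its left; this is the number that [d] has
to divide, and after division by [d] it corresponds to a cut at
[(i.+1 %/ d).-1]. *)
Definition allowed d n (s : 'S_n) (i : nat) (b : bool) : bool :=
  if (d %| i.+1)%N then descent s (i.+1 %/ d).-1 ==> b else ~~ b.

(** The cuts of [I] are at multiples of [d] and, once divided by [d], include the
descents of [s]: this constrains each bit of [I] separately, so that sums over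
[I] factor. *)
Lemma allowedP p d q (s : 'S_q.+1) (I : {ffun 'I_p.+1 -> bool}) :
  p.+1 = (q.+1 * d)%N ->
  [forall x : 'I_p.+1, block_index I x == block_index I (x %/ d * d)%N]
    && block_incr (fun y => block_index I (y * d)%N) s
  = [forall i : 'I_p.+1, allowed d s i (I i)].
Proof.
move=> epq; have d_gt0 : (0 < d)%N by case: d epq; rewrite ?muln0.
have cd_mono : {homo (fun y => block_index I (y * d)%N) : x y / (x <= y)%N}.
  by move=> x y xy; apply: block_index_mono; rewrite leq_mul2r xy orbT.
apply/andP/forallP => [[/forallP c_d /(block_incr_descent s cd_mono) incr] i|H].
  rewrite /allowed; case: ifPn => [/dvdnP[[//|j] ej]|di].
    rewrite ej mulnK //=; apply/implyP=> /incr; rewrite -ej block_indexS.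
    have /eqP -> := c_d i; rewrite (_ : (i %/ d)%N = j); last first.
      apply/eqP; rewrite eqn_leq -ltnS ltn_divLR // -ej ltnSn /= leq_divRL //.
      by rewrite -ltnS ej mulSn; lia.
    by case: (I i); rewrite //= ?addn0 ltnn.
  apply/negP=> Ii; have ltip : (i.+1 < p.+1)%N.
    rewrite ltn_neqAle ltn_ord andbT; apply: contraNneq di => ->.
    by rewrite epq dvdn_mull.
  have /eqP /= := c_d (Ordinal ltip); rewrite block_indexS Ii addn1 => e.
  suff : (block_index I (i.+1 %/ d * d) <= block_index I i)%N by rewrite -e ltnn.
  apply: block_index_mono; rewrite -ltnS ltn_neqAle leq_trunc_div andbT.
  by apply: contraNneq di => <-; rewrite dvdn_mull.
split.
  apply/forallP=> x; apply/eqP/esym/block_index_eq; first exact: leq_trunc_div.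
  move=> i /andP[xi ix]; have := H i; rewrite /allowed ifN //.
  apply/negP=> /dvdnP[k ek].
  have : (k <= x %/ d)%N by rewrite leq_divRL // -ek.
  by rewrite -(leq_pmul2r d_gt0) -ek ltnNge xi.
apply/(block_incr_descent s cd_mono) => j sj.
have jq : (j < q)%N := descent_lt sj.
have lti : ((j.+1 * d).-1 < p.+1)%N.
  by rewrite prednK ?muln_gt0 // epq leq_pmul2r // ltnW.
have ei : (j.+1 * d).-1.+1 = (j.+1 * d)%N by rewrite prednK // muln_gt0.
have := H (Ordinal lti); rewrite /allowed /= ei dvdn_mull // mulnK //= sj /= => Ii.
rewrite -ei (block_indexS I (Ordinal lti)) Ii addn1 ltnS; apply: block_index_mono => /=.
by rewrite -ltnS ei mulSn -addn1 addnC leq_add.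
Qed.

(** * Inclusion-exclusion by transfer matrices *)

Definition mx22 (a b c d : int) : 'M[int]_2 :=
  \matrix_(i, j) if i == 0 then (if j == 0 then a else b)
                 else (if j == 0 then c else d).

Lemma mx22M a b c d a' b' c' d' : mx22 a b c d * mx22 a' b' c' d' =
  mx22 (a * a' + b * c') (a * b' + b * d') (c * a' + d * c') (c * b' + d * d').
Proof.
apply/matrixP=> i j; rewrite !mxE !big_ord_recl big_ord0 !mxE /= addr0.
by case: i => [[|[|]] //] ?; case: j => [[|[|]] //] ?.
Qed.

Lemma mx22D a b c d a' b' c' d' : mx22 a b c d + mx22 a' b' c' d' =
  mx22 (a + a') (b + b') (c + c') (d + d').
Proof.
apply/matrixP=> i j; rewrite !mxE.
by case: (i == 0); case: (j == 0).
Qed.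

Lemma row0_mul (A : 'M[int]_2) a b c d j :
  (A * mx22 a b c d) 0 j = if j == 0 then A 0 0 * a + A 0 1 * c
                           else A 0 0 * b + A 0 1 * d.
Proof.
rewrite mxE !big_ord_recl big_ord0 !mxE addr0 /= (_ : lift ord0 ord0 = 1) //;
  last exact: val_inj.
by case: (j == 0).
Qed.

(** These matrices sum the signs of the sets [D] that contain [I] and have no two
consecutive elements.  The state is 1 if the last position read is in [D].  A
position of [I] has to be in [D]; another one may be left out, or put in [D] at
the cost of a sign.  State 1 may only be followed by state 0. *)
Definition transfer (b : bool) : 'M[int]_2 := if b then mx22 0 1 0 0 else mx22 1 (-1) 1 0.

Lemma prod_if_all (R : pzRingType) (I : finType) (a : pred I) (X : I -> R) :
  \prod_i (if a i then X i else 0) = if [forall i, a i] then \prod_i X i else 0.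
Proof.
case: ifPn => [/forallP H|/forallPn[j /negbTE aj]].
  by apply: eq_bigr => i _; rewrite H.
have : j \in index_enum I by rewrite mem_index_enum.
elim: (index_enum I) => //= i r IHr; rewrite inE big_cons.
by case/predU1P=> [<-|/IHr ->]; rewrite ?aj ?mul0r ?mulr0.
Qed.

(** The last index is not a possible descent: [I] and [D] avoid it, which is why the
product ends in state 0. *)
Definition transfer_coef n (I : {ffun 'I_n -> bool}) : int :=
  (\prod_(i < n) transfer (I i)) 0 0.

(** The sum of the matrices of the bits that [s] permits at [j]: a descent requires
the bit to be set, and the last index requires it to be unset. *)
Definition transfer_step q (s : 'S_q.+1) (j : nat) : 'M[int]_2 :=
  (if descent s j then 0 else transfer false) + (if j == q then 0 else transfer true).

(** By distributivity the sum is a product over the positions.  Those that are not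
the last of a group of [d] must be outside [I] and contribute [transfer false]. *)
Lemma sum_transfer_coef p d q (s : 'S_q.+1) : p.+1 = (q.+1 * d)%N ->
  \sum_(I : {ffun 'I_p.+1 -> bool} | ~~ I ord_max)
    transfer_coef I * ([forall x : 'I_p.+1, block_index I x == block_index I (x %/ d * d)%N]
              && block_incr (fun y => block_index I (y * d)%N) s)%:R
  = (\prod_(0 <= j < q.+1) (transfer false ^+ d.-1 * transfer_step s j)) 0 0.
Proof.
move=> epq; have d_gt0 : (0 < d)%N by case: d epq; rewrite ?muln0.
pose a (i : 'I_p.+1) b := allowed d s i b && ((i == p :> nat) ==> ~~ b).
pose F (i : 'I_p.+1) b := if a i b then transfer b else 0.
transitivity ((\prod_i \sum_(b : bool) F i b) 0 0).
  rewrite bigA_distr_bigA summxE big_mkcond; apply: eq_bigr => I _.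
  rewrite /F prod_if_all (allowedP _ _ epq) /transfer_coef.
  case: (boolP (I ord_max)) => /= [Imax|ImaxN].
    case: ifP => [/forallP/(_ ord_max)|_]; last by rewrite mxE.
    by rewrite /a Imax eqxx andbF.
  have -> : [forall i, a i (I i)] = [forall i : 'I_p.+1, allowed d s i (I i)].
    apply: eq_forallb => i; rewrite /a; case: eqP => [ip|]; rewrite ?andbT //.
    by rewrite (_ : i = ord_max) ?ImaxN ?andbT //; apply: val_inj.
  by case: ifP => _; rewrite ?mulr1 // mulr0 mxE.
pose G (i : nat) := if (d %| i.+1)%N then transfer_step s (i.+1 %/ d).-1 else transfer false.
congr (fun_of_matrix _ 0 0); transitivity (\prod_(0 <= i < p.+1) G i).
  rewrite big_mkord; apply: eq_bigr => i _; rewrite big_bool /F /a /G /allowed /transfer_step.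
  case: (boolP (d %| i.+1)%N) => [/dvdnP[[//|j] ej]|di]; last first.
    by rewrite /= implybT /= add0r.
  rewrite ej mulnK //= implybT implybF implybT !andbT addrC.
  have -> : (i == p :> nat) = (j == q).
    by rewrite -eqSS ej epq eqn_pmul2r // eqSS.
  by case: (descent s j); case: (j == q).
rewrite epq big_nat_mul; apply: eq_bigr => j _.
rewrite -{1}[(j * d)%N]add0n big_addn mulSn addnK -{1}(prednK d_gt0) big_nat_recr //=.
congr (_ * _).
  rewrite (eq_big_nat _ _ (F2 := fun=> transfer false)) => [|k /andP[_ kd]].
    by rewrite big_const_nat subn0 -Monoid.iteropE.
  rewrite /G ifN // -addSn dvdn_addl ?dvdn_mull // gtnNdvd //.
  by rewrite -[X in (_ < X)%N](prednK d_gt0).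
by rewrite /G -addSn prednK // -mulSn dvdn_mull // mulnK.
Qed.

(** * Values of the transfer products *)

Definition nopair (D : nat -> bool) (k : nat) : bool :=
  all (fun i => ~~ (D i && D i.+1)) (iota 0 k).

Lemma nopairS D k : nopair D k.+1 = nopair D k && ~~ (D k && D k.+1).
Proof. by rewrite /nopair -[X in iota 0 X]addn1 iotaD all_cat /= add0n andbT. Qed.

Lemma nopairP (D : nat -> bool) k :
  reflect (forall i, (i < k)%N -> ~~ (D i && D i.+1)) (nopair D k).
Proof.
by apply: (iffP allP) => H i; have := H i; rewrite mem_iota add0n; apply.
Qed.

(** The complements of the permutations counted by [gamma_star]; the value for [q = 0]
agrees with the convention [gamma_star 1 = 0]. *)
Definition descent_framed q (s : 'S_q.+1) : bool :=
  if q is k.+1 then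
    [&& descent s 0, descent s k & nopair (fun i => ~~ descent s i) k]
  else false.

Definition no_descent q (s : 'S_q.+1) : bool := all (fun i => ~~ descent s i) (iota 0 q).

Lemma descent_last q (s : 'S_q.+1) : descent s q = false.
Proof. by apply/negbTE/negP=> /descent_lt; rewrite ltnn. Qed.

Lemma transfer_step_last q (s : 'S_q.+1) : transfer_step s q = mx22 1 (-1) 1 0.
Proof. by rewrite /transfer_step descent_last eqxx addr0. Qed.

Lemma transfer_step_inner q (s : 'S_q.+1) j : (j < q)%N ->
  transfer_step s j = if descent s j then mx22 0 1 0 0 else mx22 1 0 1 0.
Proof.
move=> jq; rewrite /transfer_step (ltn_eqF jq); case: ifP => _; rewrite ?add0r //.
by rewrite /transfer mx22D.
Qed.

Lemma avoids_321E q (s : 'S_q.+1) : avoids_321 s = nopair (descent s) q.-1.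
Proof.
apply/forallP/nopairP => [H i iq|H i].
  have ltiq : (i < q.+1)%N by lia.
  exact: H (Ordinal ltiq).
case: (ltnP i q.-1) => [/H //|qi]; apply/negP=> /andP[_ /descent_lt]; lia.
Qed.

(** The first row of the partial products is an indicator: it is nonzero as long as
there are no two consecutive descents, and its 1 is in column 1 after a descent,
in column 0 after an ascent. *)
Lemma prod_transfer_step q (s : 'S_q.+1) :
  (\prod_(0 <= j < q.+1) transfer_step s j) 0 0 = (avoids_321 s)%:R.
Proof.
rewrite avoids_321E.
have inv k : (k < q)%N -> forall j,
    (\prod_(0 <= j < k.+1) transfer_step s j) 0 j
    = (nopair (descent s) k && (if j == 0 then ~~ descent s k else descent s k))%:R.
  elim: k => [|k IHk] kq j.
    rewrite big_nat1 transfer_step_inner //.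
    by case: ifP => /= _; rewrite !mxE /=; case: (j == 0).
  rewrite big_nat_recr //= transfer_step_inner // nopairS.
  have IH := IHk (ltnW kq); have {IH} [IH0 IH1] := (IH 0, IH 1).
  by case: ifP => _; rewrite row0_mul IH0 IH1 /=;
    case: (nopair _ _) (descent s k) (j == 0) => [] [] [].
rewrite big_nat_recr //= transfer_step_last row0_mul /=.
case: q s inv => [|k] s inv; first by rewrite big_nil !mxE.
rewrite !inv //=; by case: (nopair _ _) (descent s k) => [] [].
Qed.

(** The same computation, where now the first row vanishes after a first ascent and
after two consecutive ascents, and where the last factor keeps only column 1. *)
Lemma prod_transfer_mul_step q (s : 'S_q.+1) :
  (\prod_(0 <= j < q.+1) (transfer false * transfer_step s j)) 0 0 = (descent_framed s)%:R.
Proof.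
pose A k := descent s 0 && nopair (fun i => ~~ descent s i) k.
have inv k : (k < q)%N -> forall j,
    (\prod_(0 <= j < k.+1) (transfer false * transfer_step s j)) 0 j
    = (A k && (if j == 0 then ~~ descent s k else descent s k))%:R.
  elim: k => [|k IHk] kq j.
    rewrite big_nat1 transfer_step_inner // /A.
    by case: ifP => /= _; rewrite mx22M !mxE /=; case: (j == 0).
  rewrite big_nat_recr //= transfer_step_inner // /A nopairS andbA -/(A k).
  have IH := IHk (ltnW kq); have {IH} [IH0 IH1] := (IH 0, IH 1).
  by case: ifP => _; rewrite mx22M row0_mul IH0 IH1 /=;
    case: (A k) (descent s k) (j == 0) => [] [] [].
rewrite big_nat_recr //= transfer_step_last mx22M row0_mul /=.
rewrite /A in inv; clear A; case: q s inv => [|k] s inv; first by rewrite big_nil !mxE.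
rewrite !inv //=.
by case: (descent s 0) (nopair _ _) (descent s k) => [] [] [].
Qed.

Lemma transfer_sq : transfer false ^+ 2 = mx22 0 (-1) 1 (-1).
Proof. by rewrite expr2 mx22M. Qed.

(** A descent annihilates the first row, which any other position multiplies
by -1. *)
Lemma prod_transfer_sq_mul_step q (s : 'S_q.+1) :
  (\prod_(0 <= j < q.+1) (transfer false ^+ 2 * transfer_step s j)) 0 0
  = (-1) ^+ q.+1 * (no_descent s)%:R.
Proof.
rewrite transfer_sq.
have inv k : (k <= q)%N -> forall j,
    (\prod_(0 <= j < k) (mx22 0 (-1) 1 (-1) * transfer_step s j)) 0 j
    = if j == 0 then (-1) ^+ k * (all (fun i => ~~ descent s i) (iota 0 k))%:R else 0.
  elim: k => [|k IHk] kq j; first by rewrite big_nil !mxE mulr1 eq_sym; case: (j == 0).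
  rewrite -[X in iota 0 X]addn1 iotaD all_cat /= add0n andbT exprS.
  rewrite big_nat_recr //= transfer_step_inner //.
  have IH := IHk (ltnW kq); have {IH} [IH0 IH1] := (IH 0, IH 1).
  case: (descent s k); rewrite mx22M row0_mul IH0 IH1 /= ?andbF ?andbT /=;
    by case: (j == 0); ring.
rewrite big_nat_recr //= transfer_step_last mx22M row0_mul !inv //=.
by rewrite /no_descent exprS; ring.
Qed.

Lemma transfer_cube : transfer false ^+ 3 = -1.
Proof.
rewrite exprS transfer_sq mx22M; apply/matrixP=> i j; rewrite !mxE.
by case: i => [[|[|]] //] ?; case: j => [[|[|]] //] ?.
Qed.

Lemma prod_sign (e n : nat) (X : nat -> 'M[int]_2) :
  (\prod_(0 <= j < n) ((-1) ^+ e * X j)) 0 0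
  = (-1) ^+ (e * n) * (\prod_(0 <= j < n) X j) 0 0.
Proof.
have -> : \prod_(0 <= j < n) ((-1) ^+ e * X j) = (-1) ^+ (e * n) * \prod_(0 <= j < n) X j.
  elim: n => [|n IHn]; first by rewrite !big_nil muln0 mul1r.
  rewrite !big_nat_recr //= IHn mulnS addnC exprD -!mulrA; congr (_ * _).
  by rewrite !mulrA; congr (_ * _); apply: commr_sign.
rewrite -signr_odd -[in RHS]signr_odd.
by case: (odd _); rewrite ?expr0 ?expr1 ?mul1r // !mulN1r mxE.
Qed.

Definition weight q d (s : 'S_q.+1) : int :=
  (\prod_(0 <= j < q.+1) (transfer false ^+ d.-1 * transfer_step s j)) 0 0.

Lemma weightE q d r (s : 'S_q.+1) :
  weight (3 * d + r).+1%N s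
  = (-1) ^+ (d * q.+1) * (\prod_(0 <= j < q.+1) (transfer false ^+ r * transfer_step s j)) 0 0.
Proof.
rewrite /weight -prod_sign; congr (fun_of_matrix _ 0 0); apply: eq_bigr => j _.
by rewrite exprD exprM transfer_cube mulrA.
Qed.

Lemma weight_mod1 q d (s : 'S_q.+1) : (d %% 3 = 1)%N ->
  weight d s = (-1) ^+ ((d - 1) * q.+1) * (avoids_321 s)%:R.
Proof.
move=> d1; have -> : d = (3 * (d %/ 3) + 0).+1%N by rewrite {1}(divn_eq d 3) d1; lia.
rewrite weightE; under eq_bigr do rewrite expr0 mul1r.
rewrite prod_transfer_step; congr (_ * _); rewrite -signr_odd -[RHS]signr_odd.
by rewrite subn1 /= addn0 !oddM.
Qed.

Lemma weight_mod2 q d (s : 'S_q.+1) : (d %% 3 = 2)%N ->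
  weight d s = (-1) ^+ (d * q.+1) * (descent_framed s)%:R.
Proof.
move=> d2; have -> : d = (3 * (d %/ 3) + 1).+1%N by rewrite {1}(divn_eq d 3) d2; lia.
rewrite weightE; under eq_bigr do rewrite expr1.
rewrite prod_transfer_mul_step; congr (_ * _); rewrite -signr_odd -[RHS]signr_odd.
by rewrite !oddM /= oddD oddM /= addbT negbK.
Qed.

Lemma weight_mod0 q d (s : 'S_q.+1) : (0 < d)%N -> (3 %| d)%N ->
  weight d s = (-1) ^+ (d * q.+1) * (no_descent s)%:R.
Proof.
move=> d_gt0 /dvdnP[[|e] ed]; first by rewrite ed in d_gt0.
have {ed} -> : d = (3 * e + 2).+1%N by lia.
rewrite weightE prod_transfer_sq_mul_step mulrA -exprD; congr (_ * _).
rewrite -signr_odd -[RHS]signr_odd.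
by rewrite !oddD !oddM /= oddD oddM /= addbF; case: odd; case: odd.
Qed.

(** * Counting permutations by weight *)

Definition complement n (s : 'S_n) : 'S_n := (s * perm (@rev_ord_inj n))%g.

Lemma complementK n : involutive (@complement n).
Proof. by move=> s; apply/permP=> x; rewrite !permM !permE rev_ordK. Qed.

Lemma descent_complement n (s : 'S_n) i : descent (complement s) i = ascent s i.
Proof.
apply: eq_existsb => x; apply: eq_existsb => y; rewrite !permM !permE /=.
by have := ltn_ord (s x); have := ltn_ord (s y); case: (_ == i); case: (_ == i.+1) => //=; lia.
Qed.

Lemma ascentE q (s : 'S_q.+1) i : (i < q)%N -> ascent s i = ~~ descent s i.
Proof.
move=> iq; have i1 : (i < q.+1)%N by apply: ltnW.
rewrite -descent_complement -[i]/(val (Ordinal i1)).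
rewrite (@descentE _ _ _ (Ordinal (iq : i.+1 < q.+1)%N)) //.
rewrite (@ndescentE _ _ _ (Ordinal (iq : i.+1 < q.+1)%N)) // !permM !permE /=.
by rewrite ltn_sub2lE // ltn_ord.
Qed.

Lemma card_complement n (P Q : pred 'S_n) : (forall s, P (complement s) = Q s) ->
  #|[set s | P s]| = #|[set s | Q s]|.
Proof.
move=> PQ; rewrite -(card_imset _ (can_inj (@complementK n))).
apply: eq_card => s; rewrite inE; apply/imsetP/idP => [[s' + ->]|Qs].
  by rewrite inE -PQ complementK.
by exists (complement s); rewrite ?complementK // inE PQ.
Qed.

Lemma gammaE n : gamma n = #|[set s : 'S_n | avoids_321 s]|.
Proof.
apply/esym/card_complement => s; apply: eq_forallb => i.
by rewrite !descent_complement.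
Qed.

Lemma gamma_starE q : gamma_star q.+1 = #|[set s : 'S_q.+1 | descent_framed s]|.
Proof.
case: q => [|k] /=.
  by apply/esym/eqP; rewrite cards_eq0; apply/eqP/setP=> s; rewrite !inE.
apply/esym/card_complement=> s.
rewrite avoids_321E /= !descent_complement andbA andbC; congr (_ && _).
by apply: eq_in_all => i; rewrite mem_iota add0n /= => ik;
  rewrite !descent_complement !ascentE ?negbK //; lia.
Qed.

Lemma card_no_descent q : #|[set s : 'S_q.+1 | no_descent s]| = 1%N.
Proof.
rewrite -(cards1 (1%g : 'S_q.+1)); congr #|pred_of_set _|; apply/setP=> s.
rewrite !inE; apply/allP/eqP => [H|-> i _]; last first.
  apply/negP=> /descentP[x [y [xi yi]]]; rewrite !perm1 xi yi; lia.
have /block_incrP s_incr : block_incr (fun=> 0%N) s.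
  apply/block_incr_descent => // i di; have := H i.
  by rewrite mem_iota add0n (descent_lt di) di => /(_ isT).
apply/permP=> x; apply: val_inj; rewrite perm1; move: x.
apply: (@homo_perm_eq _ (fun x => val (s x)) val) => [x y xy|x y|].
- by apply/ltnW/s_incr.
- exact: ltnW.
exact: (map_perm_enum val s).
Qed.

(** Matching on [m] allows [m] to be a quotient such as [n %/ d], which is not
syntactically a successor. *)
Definition weight_sum d m : int :=
  if m is q.+1 then \sum_(s : 'S_q.+1) weight d s else 0.

Lemma sum_card_pred q (P : pred 'S_q.+1) : \sum_s (P s)%:R = #|[set s | P s]|%:R :> int.
Proof.
rewrite -sum1_card natr_sum [RHS]big_mkcond; apply: eq_bigr => s _.
by rewrite inE; case: (P s).
Qed.

Lemma weight_sum_mod1 d m : (0 < m)%N -> (d %% 3 = 1)%N ->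
  weight_sum d m = (-1) ^+ ((d - 1) * m) * (gamma m)%:R.
Proof.
case: m => // q _ d1; rewrite /= gammaE -sum_card_pred mulr_sumr.
by apply: eq_bigr => s _; rewrite weight_mod1.
Qed.

Lemma weight_sum_mod2 d m : (0 < m)%N -> (d %% 3 = 2)%N ->
  weight_sum d m = (-1) ^+ (d * m) * (gamma_star m)%:R.
Proof.
case: m => // q _ d2; rewrite gamma_starE /weight_sum -sum_card_pred mulr_sumr.
by apply: eq_bigr => s _; rewrite weight_mod2.
Qed.

Lemma weight_sum_mod0 d m : (0 < m)%N -> (0 < d)%N -> (3 %| d)%N ->
  weight_sum d m = (-1) ^+ (d * m).
Proof.
case: m => // q _ d_gt0 d3.
have <- : (-1) ^+ (d * q.+1) * #|[set s : 'S_q.+1 | no_descent s]|%:R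
    = (-1) ^+ (d * q.+1) :> int by rewrite card_no_descent mulr1.
rewrite -sum_card_pred mulr_sumr.
by apply: eq_bigr => s _; rewrite weight_mod0.
Qed.

Lemma sum_transfer_coef_block_incr p (s : 'S_p.+1) :
  \sum_(I : {ffun 'I_p.+1 -> bool} | ~~ I ord_max)
    transfer_coef I * (block_incr (block_index I) s)%:R
  = (avoids_321 s)%:R.
Proof.
have e1 : p.+1 = (p.+1 * 1)%N by rewrite muln1.
rewrite -prod_transfer_step; under [in RHS]eq_bigr do rewrite -[transfer_step s _]mul1r.
rewrite -(sum_transfer_coef s e1); apply: eq_bigr => I _; congr (_ * (_ : bool)%:R).
rewrite (_ : [forall x, _] = true) /=; last first.
  by apply/forallP=> x; rewrite divn1 muln1.
by apply: eq_forallb => x; apply: eq_forallb => y; rewrite !muln1.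
Qed.

(** Expand the avoidance over the sets [I], count for each [I] the cycles with
descents in [I], and sum over [I] again inside each term of the Moebius sum. *)
Lemma card_cycles_weight p :
  (p.+1 * #|[set s : 'S_p.+1 | is_ncycle s && avoids_321 s]|)%N%:R
  = \sum_(d <- divisors p.+1) mobius d * weight_sum d (p.+1 %/ d).
Proof.
rewrite (card_ncycles (@avoids_321 p.+1)) -sum_card_pred.
under eq_bigr do rewrite -sum_transfer_coef_block_incr.
rewrite exchange_big /=.
under eq_bigr => I _ do rewrite -mulr_sumr sum_card_pred
  (card_block_incr_cycle_of_mobius _ (@block_index_mono _ I)) mulr_sumr.
rewrite exchange_big /= big_seq [RHS]big_seq; apply: eq_bigr => d.
rewrite -dvdn_divisors // => dn.
have : (0 < p.+1 %/ d)%N by rewrite divn_gt0 ?(dvdn_leq _ dn) ?(dvdn_gt0 _ dn).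
have : p.+1 = (p.+1 %/ d * d)%N by rewrite divnK.
case: (p.+1 %/ d)%N => // q epq _; rewrite /weight_sum mulr_sumr.
under [RHS]eq_bigr => s _ do rewrite /weight -(sum_transfer_coef s epq) mulr_sumr.
rewrite [RHS]exchange_big /=; apply: eq_bigr => I _.
rewrite mulrCA -mulr_sumr -mulr_sumr; congr (_ * (_ * _)).
case: ifP => _ /=; first by rewrite sum_card_pred.
by rewrite big1.
Qed.

(** * Cycles avoiding two consecutive descents *)

Theorem theorem6p8 (n : nat) (n_ge1 : (1 <= n)%N) :
  #|[set s : 'S_n | is_ncycle s && avoids_321 s]|%:R =
  n%:R^-1 *
  ((theta_tilde n)%:R
   + \sum_(d <- divisors n | d == 1 %[mod 3])
       (mobius d)%:~R * (-1) ^+ ((d - 1) * (n %/ d))%N * (gamma (n %/ d))%:R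
   + (-1) ^+ n *
     \sum_(d <- divisors n | d == 2 %[mod 3])
       (mobius d)%:~R * (gamma_star (n %/ d))%:R) :> rat.
Proof.
case: n n_ge1 => // p _; apply: (mulfI (_ : p.+1%:R != 0 :> rat)).
  by rewrite Num.Theory.pnatr_eq0.
rewrite mulVKf ?Num.Theory.pnatr_eq0 // -natrM.
have dvd_pos d : d \in divisors p.+1 ->
    [/\ (0 < d)%N, (0 < p.+1 %/ d)%N & (d * (p.+1 %/ d))%N = p.+1].
  rewrite -dvdn_divisors // => dn; have d_gt0 := dvdn_gt0 (ltn0Sn p) dn.
  by rewrite divn_gt0 // (dvdn_leq _ dn) // mulnC divnK.
set N := #|_|; transitivity (((p.+1 * N)%N%:R : int)%:~R : rat).
  by rewrite rmorph_nat.
rewrite {}/N card_cycles_weight (bigID (fun d => (3 %| d)%N)) /=.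
rewrite [X in _ + X](bigID (fun d => d == 1 %[mod 3])) /= addrA.
have part0 : \sum_(d <- divisors p.+1 | (3 %| d)%N) mobius d * weight_sum d (p.+1 %/ d)
    = (theta_tilde p.+1)%:R.
  transitivity ((-1) ^+ p.+1 * \sum_(d <- divisors p.+1 | (3 %| d)%N) mobius d).
    rewrite mulr_sumr big_seq_cond [RHS]big_seq_cond.
    apply: eq_bigr => d /andP[/dvd_pos[d0 m0 dm] d3].
    by rewrite weight_sum_mod0 // dm mulrC.
  rewrite sum_mobius_dvd3 //; case: (boolP (theta_tilde p.+1 == 0%N)) => [/eqP ->|].
    by rewrite oppr0 mulr0.
  rewrite /theta_tilde eqb0 negbK => th; rewrite th.
  case/existsP: th => a /andP[_ /eqP ->].
  by rewrite -signr_odd oddX orbT expr1 mulrNN mulr1.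
rewrite {}part0 !rmorphD /= -!addrA; congr (_ + _); first by rewrite rmorph_nat.
have E1 d : (~~ (3 %| d)%N && (d == 1 %[mod 3])) = (d == 1 %[mod 3]).
  by apply/andb_idl; rewrite /dvdn => /eqP ->.
have E2 d : (~~ (3 %| d)%N && (d != 1 %[mod 3])) = (d == 2 %[mod 3]).
  by rewrite /dvdn; have := ltn_pmod d (isT : 0 < 3)%N; case: (d %% 3)%N => [|[|[|]]].
rewrite (eq_bigl _ _ E1) (eq_bigl _ _ E2) mulr_sumr !rmorph_sum /=.
congr (_ + _); rewrite big_seq_cond [RHS]big_seq_cond;
  apply: eq_bigr => d /andP[/dvd_pos[d0 m0 dm] /eqP dmod].
  rewrite weight_sum_mod1 // !rmorphM /= rmorphXn rmorphN1 rmorph_nat mulrA.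
  by [].
rewrite weight_sum_mod2 // dm !rmorphM /= rmorphXn rmorphN1 rmorph_nat mulrCA.
by [].
Qed.
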